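(* Suppose that customers have access to behind-the-meter renewables $r^i(\omega^i)$ and storage of capacity $\theta^i$, $i=1,\dots,M$. If the wholesale prices $\lambda$ and the customers' states $\omega=(\omega^1,\dots,\omega^M)$ are statistically independent, then the two-part net-metering tariff $T^*_{\mathrm{dec}}(d)=A^*_{\mathrm{dec}}+\pi^{*\top}_{\mathrm{dec}}d$ is an optimal solution of the regulator's problem $$\max_{T(\cdot)}\ \overline{\mathrm{cs}}(T)\quad\text{subject to}\quad\overline{\mathrm{rs}}(T)=F$$ among the class of all ex-ante tariffs $T:\mathbb{R}^N\to\mathbb{R}$.
   Context: A billing cycle has $N$ periods and there are $M$ customers. Customer $i$ has a random local state $\omega^i=(\omega^i_1,\dots,\omega^i_N)\in\mathbb{R}^N$; $\omega=(\omega^1,\dots,\omega^M)$. The random vector of wholesale prices is $\lambda\in\mathbb{R}^N$, with mean $\overline\lambda=\mathbb{E}[\lambda]$, and $\xi=(\lambda,\omega)$. All expectations appearing are assumed to exist and be finite. $\operatorname{Cov}(X,Y)=\mathbb{E}[(X-\mathbb{E}X)(Y-\mathbb{E}Y)^{\top}]$. $F\in\mathbb{R}$ is a constant (the retailer's non-energy costs). Demand: $S^i(q,\omega^i)\in\mathbb{R}$ is the gross benefit of customer $i$ from consuming the profile $q\in\mathbb{R}^N$. A policy $\omega^i\mapsto q(\omega^i)\in\mathbb{R}^N$ is causal if its $k$-th component depends only on $\omega^i_1,\dots,\omega^i_k$. For each price vector $\pi\in\mathbb{R}^N$, the demand function $\omega^i\mapsto D^i(\pi,\omega^i)$ is the causal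 policy maximizing $\mathbb{E}[S^i(q(\omega^i),\omega^i)-\pi^{\top}q(\omega^i)]$. It is assumed that $D^i(\cdot,\omega^i)$ is nonnegative, continuously differentiable in $\pi$, with negative definite Jacobian $\nabla_\pi D^i(\pi,\omega^i)\in\mathbb{R}^{N\times N}$. Let $D(\pi,\omega)=\sum_{i=1}^M D^i(\pi,\omega^i)$. Standing assumption: $g(\pi)=\mathbb{E}[\nabla_\pi D(\pi,\omega)(\pi-\lambda)]$ has a negative definite Jacobian matrix $\nabla g(\pi)$. Storage: for a capacity $\theta\ge 0$, the feasible discharge vectors are $\mathcal{U}(\theta)=\{s\in\mathbb{R}^N: 0\le-\sum_{t=1}^k s_t\le\theta,\ k=1,\dots,N\}$. For $\pi\in\mathbb{R}^N$, $s^*(\pi,\theta)$ denotes an optimal solution of $\max\{\pi^{\top}s: s\in\mathcal{U}(\theta)\}$. Decentralized integration (net metering): customer $i$ has a state-contingent renewable profile $r^i(\omega^i)\in\mathbb{R}^N_+$ available at no cost and storage of capacity $\theta^i\ge0$; $r(\omega)=\sum_{i=1}^M r^i(\omega^i)$. With consumption $q^i$ and storage discharge $s^i$, net demand is $d^i=q^i-r^i-s^i$. An ex-ante tariff is a function $T:\mathbb{R}^N\to\mathbb{R}$, fixed before the billing cycle, charged to each customer on $d^i$. Given $T$, customer $i$ chooses causal policies $q^{i*}(T,\cdot),s^{i*}(T,\cdot)$ attaining $$\overline{\mathrm{cs}}^i(T)=\max_{q^i(\cdot),s^i(\cdot)\text{ causal}}\mathbb{E}\big[S^i(q^i(\omega^i),\omega^i)-T(q^i(\omega^i)-r^i(\omega^i)-s^i(\omega^i))\big]\quad\text{s.t.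 } s^i(\omega^i)\in\mathcal{U}(\theta^i),$$ with resulting net demand $d^{i*}(T,\omega^i)=q^{i*}(T,\omega^i)-r^i(\omega^i)-s^{i*}(T,\omega^i)$. For a two-part tariff $T(d)=A+\pi^{\top}d$ these choices are $q^{i*}=D^i(\pi,\omega^i)$ and $s^{i*}=s^*(\pi,\theta^i)$. Put $\overline{\mathrm{cs}}(T)=\sum_{i=1}^M\overline{\mathrm{cs}}^i(T)$ and $\overline{\mathrm{rs}}(T)=\mathbb{E}\big[\sum_{i=1}^M\big(T(d^{i*}(T,\omega^i))-\lambda^{\top}d^{i*}(T,\omega^i)\big)\big]$. The tariff $T^*_{\mathrm{dec}}$ is given by $\pi^*_{\mathrm{dec}}=\overline\lambda$ and $A^*_{\mathrm{dec}}=A^*-\frac1M\operatorname{Tr}(\operatorname{Cov}(\lambda,r(\omega)))$, where $A^*=\frac1M\big(F+\operatorname{Tr}(\operatorname{Cov}(\lambda,D(\overline\lambda,\omega)))\big)$. *)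

(* Defs.v *)
From HB Require Import structures.
From mathcomp Require Import all_boot all_order all_algebra.
From mathcomp Require Import all_classical all_reals all_analysis.

Set Implicit Arguments.
Unset Strict Implicit.
Unset Printing Implicit Defensive.

Import Order.TTheory GRing.Theory Num.Theory.
Import numFieldNormedType.Exports.

Local Open Scope classical_set_scope.
Local Open Scope ring_scope.

(* Product sigma-algebra on matrices, generated by the entries; for real
   entries this is the Borel sigma-algebra of R^(m x n). *)
Definition measure_mx_display : measure_display -> measure_display.
Proof. exact. Qed.

Section measurable_matrix.
Context {d} {T : sigmaRingType d} {m n : nat}.

Let entry_cylinders : set (set 'M[T]_(m, n)) :=
  [set C | exists i j (B : set T), measurable B /\ C = [set A : 'M[T]_(m, n) | B (A i j)]].

Let mx_set0 : <<s entry_cylinders >> set0.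
Proof. exact: sigma_algebra0. Qed.

Let mx_setC A : <<s entry_cylinders >> A -> <<s entry_cylinders >> (~` A).
Proof. exact: sigma_algebraC. Qed.

Let mx_bigcup (F : _^nat) : (forall i, <<s entry_cylinders >> (F i)) ->
  <<s entry_cylinders >> (\bigcup_i (F i)).
Proof. exact: sigma_algebra_bigcup. Qed.

HB.instance Definition _ := @isMeasurable.Build (measure_mx_display d)
  'M[T]_(m, n) <<s entry_cylinders >> mx_set0 mx_setC mx_bigcup.

End measurable_matrix.

Section linear_algebra.
Context {R : realType} {N : nat}.
Implicit Types u v s : 'rV[R]_N.

Definition dotv u v : R := (u *m v^T) 0 0.

(* Symmetry of A is not required. *)
Definition negative_definite (A : 'M[R]_N) : Prop :=
  forall u, u != 0 -> dotv (u *m A) u < 0.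

Definition storage_feasible (theta : R) : set 'rV[R]_N :=
  [set s | forall k : 'I_N, 0 <= - \sum_(t < N | (t <= k)%N) s 0 t <= theta].

Definition optimal_discharge (pi : 'rV[R]_N) (theta : R) s : Prop :=
  storage_feasible theta s /\
  forall s', storage_feasible theta s' -> dotv pi s' <= dotv pi s.

Definition two_part_tariff (A : R) (pi : 'rV[R]_N) : 'rV[R]_N -> R :=
  fun net => A + dotv pi net.

Definition causal (q : 'rV[R]_N -> 'rV[R]_N) : Prop :=
  forall (k : 'I_N) (w w' : 'rV[R]_N),
    (forall j : 'I_N, (j <= k)%N -> w 0 j = w' 0 j) -> q w 0 k = q w' 0 k.

Definition causal_policy (q : 'rV[R]_N -> 'rV[R]_N) : Prop :=
  measurable_fun [set: 'rV[R]_N] q /\ causal q.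

End linear_algebra.

Section random_vectors.
Context {d} {Omega : measurableType d} {R : realType}.
Variable P : probability Omega R.

Definition finite_mean (X : Omega -> R) : Prop :=
  P.-integrable [set: Omega] (EFin \o X).

Definition finite_meanv {N} (X : Omega -> 'rV[R]_N) : Prop :=
  forall k, finite_mean (fun x => X x 0 k).

Definition meanv {N} (X : Omega -> 'rV[R]_N) : 'rV[R]_N :=
  \row_k fine 'E_P[fun x => X x 0 k].

Definition covmx {N} (X Y : Omega -> 'rV[R]_N) : 'M[R]_N :=
  \matrix_(j, k) fine (covariance P (fun x => X x 0 j) (fun x => Y x 0 k)).

Definition independent_RV {d1 d2} {T1 : measurableType d1}
    {T2 : measurableType d2} (X : Omega -> T1) (Y : Omega -> T2) : Prop :=
  forall (A : set T1) (B : set T2), measurable A -> measurable B ->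
    (P (X @^-1` A `&` Y @^-1` B) = P (X @^-1` A) * P (Y @^-1` B))%E.

End random_vectors.

(* One customer, with random local state W and gross benefit S.  A maximum over
   policies ranges over those whose objective has a finite expectation. *)
Section customer.
Context {d} {Omega : measurableType d} {R : realType} {N : nat}.
Variables (P : probability Omega R) (W : Omega -> 'rV[R]_N).
Variable S : 'rV[R]_N -> 'rV[R]_N -> R.

Definition linear_surplus (pi : 'rV[R]_N) (q : 'rV[R]_N -> 'rV[R]_N) :
    Omega -> R :=
  fun x => S (q (W x)) (W x) - dotv pi (q (W x)).

Definition is_demand (pi : 'rV[R]_N) (q : 'rV[R]_N -> 'rV[R]_N) : Prop :=
  [/\ causal_policy q, finite_mean P (linear_surplus pi q) &
    forall q', causal_policy q' -> finite_mean P (linear_surplus pi q') ->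
      ('E_P[linear_surplus pi q'] <= 'E_P[linear_surplus pi q])%E].

Variables (r : 'rV[R]_N -> 'rV[R]_N) (theta : R).

(* qs.1 is the consumption policy, qs.2 the storage discharge policy. *)
Let policies : Type :=
  (('rV[R]_N -> 'rV[R]_N) * ('rV[R]_N -> 'rV[R]_N))%type.

Definition net_demand (qs : policies) : Omega -> 'rV[R]_N :=
  fun x => qs.1 (W x) - r (W x) - qs.2 (W x).

Definition net_surplus (T : 'rV[R]_N -> R) (qs : policies) : Omega -> R :=
  fun x => S (qs.1 (W x)) (W x) - T (net_demand qs x).

Definition admissible (T : 'rV[R]_N -> R) : set policies :=
  [set qs | [/\ causal_policy qs.1, causal_policy qs.2,
    forall x, storage_feasible theta (qs.2 (W x)) &
    finite_mean P (net_surplus T qs)]].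

Definition customer_surplus (T : 'rV[R]_N -> R) : \bar R :=
  ereal_sup [set ('E_P[net_surplus T qs])%E | qs in admissible T].

Definition optimal_choice (T : 'rV[R]_N -> R) (qs : policies) : Prop :=
  admissible T qs /\ ('E_P[net_surplus T qs] = customer_surplus T)%E.

End customer.

(* Row i of the random matrix omega is the local state of customer i. *)
Section aggregate_demand.
Context {d} {Omega : measurableType d} {R : realType} {M N : nat}.
Variables (P : probability Omega R).
Variables (lambda : Omega -> 'rV[R]_N) (omega : Omega -> 'M[R]_(M, N)).
Variable D : 'I_M -> 'rV[R]_N -> 'rV[R]_N -> 'rV[R]_N.

Definition local_state (i : 'I_M) : Omega -> 'rV[R]_N :=
  fun x => row i (omega x).

Definition total_demand (pi : 'rV[R]_N) (x : Omega) : 'rV[R]_N :=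
  \sum_i D i pi (local_state i x).

(* The conditions of regular_demand and regular_g are relative to an open set of
   admissible prices: when imposed at every price of R^N they can be jointly
   unsatisfiable (for M = N = 1 and a deterministic demand, g' < 0 beyond the mean price
   forces D'(p) <= - c / (p - mean) with c > 0, hence D -> -oo). *)
Definition regular_demand (prices : set 'rV[R]_N) : Prop :=
  forall (i : 'I_M) (x : Omega) (pi : 'rV[R]_N), prices pi ->
    let Di := fun p => D i p (local_state i x) in
    [/\ forall k, 0 <= Di pi 0 k, differentiable Di pi,
        {for pi, continuous (jacobian Di)} & negative_definite ('J Di pi)].

(* The library's Jacobian acts on row vectors: ('J f p) i j is the derivative of
   f_j in direction i.  Hence v *m 'J f p is the transpose of the usual
   Jacobian of f at p applied to the column v. *)
Definition weighted_price_gap (pi : 'rV[R]_N) : Omega -> 'rV[R]_N :=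
  fun x => (pi - lambda x) *m 'J (total_demand^~ x) pi.

Definition g_map (pi : 'rV[R]_N) : 'rV[R]_N :=
  meanv P (weighted_price_gap pi).

Definition regular_g (prices : set 'rV[R]_N) : Prop :=
  forall pi : 'rV[R]_N, prices pi ->
    [/\ finite_meanv P (weighted_price_gap pi), differentiable g_map pi &
        negative_definite ('J g_map pi)].

End aggregate_demand.

Section regulator.
Context {d} {Omega : measurableType d} {R : realType} {M N : nat}.
Variables (P : probability Omega R).
Variables (lambda : Omega -> 'rV[R]_N) (omega : Omega -> 'M[R]_(M, N)).
Variable S : 'I_M -> 'rV[R]_N -> 'rV[R]_N -> R.
Variables (r : 'I_M -> 'rV[R]_N -> 'rV[R]_N) (theta : 'I_M -> R).

Let W := local_state omega.

(* choice T i is the pair of consumption and storage policies that customer i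
   selects when facing the tariff T. *)
Variable choice : ('rV[R]_N -> R) -> 'I_M ->
  ('rV[R]_N -> 'rV[R]_N) * ('rV[R]_N -> 'rV[R]_N).

Definition rational_choice : Prop :=
  forall T i, (exists qs, optimal_choice P (W i) (S i) (r i) (theta i) T qs) ->
    optimal_choice P (W i) (S i) (r i) (theta i) T (choice T i).

Definition cs_bar (T : 'rV[R]_N -> R) : \bar R :=
  (\sum_i customer_surplus P (W i) (S i) (r i) (theta i) T)%E.

Definition retailer_margin (T : 'rV[R]_N -> R) (i : 'I_M) : Omega -> R :=
  fun x => let net := net_demand (W i) (r i) (choice T i) x in
    T net - dotv (lambda x) net.

Definition rs_bar (T : 'rV[R]_N -> R) : \bar R :=
  ('E_P[fun x => (\sum_i retailer_margin T i x)%R])%E.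

(* T itself is an arbitrary function; it only has to induce well-defined
   customer choices and finite expectations. *)
Definition regulator_feasible (F : R) (T : 'rV[R]_N -> R) : Prop :=
  [/\ forall i, optimal_choice P (W i) (S i) (r i) (theta i) T (choice T i),
      forall i, finite_mean P (retailer_margin T i) &
      rs_bar T = F%:E].

Definition regulator_optimal (F : R) (T : 'rV[R]_N -> R) : Prop :=
  regulator_feasible F T /\
  forall T', regulator_feasible F T' -> (cs_bar T' <= cs_bar T)%E.

End regulator.

Section optimal_tariff.
Context {d} {Omega : measurableType d} {R : realType} {M N : nat}.
Variables (P : probability Omega R).
Variables (lambda : Omega -> 'rV[R]_N) (omega : Omega -> 'M[R]_(M, N)).
Variable D : 'I_M -> 'rV[R]_N -> 'rV[R]_N -> 'rV[R]_N.
Variable r : 'I_M -> 'rV[R]_N -> 'rV[R]_N.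

Definition total_renewables (x : Omega) : 'rV[R]_N :=
  \sum_i r i (local_state omega i x).

Definition A_star (F : R) : R :=
  M%:R^-1 *
  (F + \tr (covmx P lambda (total_demand omega D (meanv P lambda)))).

Definition A_dec (F : R) : R :=
  A_star F - M%:R^-1 * \tr (covmx P lambda total_renewables).

Definition T_dec (F : R) : 'rV[R]_N -> R :=
  two_part_tariff (A_dec F) (meanv P lambda).

End optimal_tariff.

(* Main.v *)
Require Import Defs.
From HB Require Import structures.
From mathcomp Require Import all_boot all_order all_algebra.
From mathcomp Require Import all_classical all_reals all_analysis.
From mathcomp Require Import measurable_realfun.
From mathcomp Require Import ring lra.

Set Implicit Arguments.
Unset Strict Implicit.
Unset Printing Implicit Defensive.

Import Order.TTheory GRing.Theory Num.Theory.
Import numFieldNormedType.Exports.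

Local Open Scope classical_set_scope.
Local Open Scope ring_scope.

(** Under a tariff T, what a customer gains and what the retailer earns on that
    customer always add up to S(q) - lambda . d, with d the net demand: the
    payment T(d) cancels.  Since q and d are functions of the customer's state,
    which is independent of lambda, Fubini's theorem replaces lambda by its mean
    in the expectation of this total ([expectation_price_mean]).  But
    S(q) - mean(lambda) . d is, up to the constant A, the customer's own
    objective under the two-part tariff A + mean(lambda) . d.  Hence whatever
    policy T induces is also available under that two-part tariff, and
      E[surplus under T] <= cs(two-part tariff) + A - E[margin under T]
    ([customer_surplus_bound]).  Summing over the M customers, a tariff meeting
    the budget F leaves the customers at most cs(two-part tariff) + M A - F.

    For the tariff of the theorem M A = F, because the covariances of lambda
    with functions of omega vanish, and the retailer's expected margin is
    exactly A per customer because its price is the mean of lambda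
    ([net_margin_two_part]); so this tariff is feasible and the bound reads
    cs(T) <= cs(two-part tariff).  That its prescribed choices are optimal
    for the customers is [two_part_optimal_choice]: the linear objective splits
    into a demand problem, a storage problem and terms that the customer does
    not control.

    The delicate point is integrability: for an arbitrary T neither S(q), T(d)
    nor d need have a mean.  Only the total S(q) - lambda . d is known to be
    integrable, so the averaging over lambda is done on that total as a whole,
    under the product of the laws of omega and lambda. *)

(** * Random vectors and dot products *)

Section measurable_matrices.
Context {d dT} {U : measurableType d} {T : measurableType dT} {m n : nat}.

Lemma measurable_entry (i : 'I_m) (j : 'I_n) :
  measurable_fun [set: 'M[T]_(m, n)] (fun A : 'M[T]_(m, n) => A i j).
Proof.
by move=> _ B mB; rewrite setTI; apply: sub_sigma_algebra; exists i, j, B.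
Qed.

Lemma measurable_mxP (f : U -> 'M[T]_(m, n)) :
  (forall i j, measurable_fun [set: U] (fun x => f x i j)) ->
  measurable_fun [set: U] f.
Proof.
move=> mf; apply: (@measurability _ _ _ _ _ _
  [set C | exists i j (B : set T),
     measurable B /\ C = [set A : 'M[T]_(m, n) | B (A i j)]]); first by [].
by move=> _ [_ [i [j [B [mB ->]]]] <-]; exact: mf.
Qed.

End measurable_matrices.

Section measurable_vectors.
Context {d} {U : measurableType d} {R : realType} {N : nat}.
Implicit Types u v : U -> 'rV[R]_N.

Lemma measurable_row M (i : 'I_M) :
  measurable_fun [set: 'M[R]_(M, N)] (fun A => row i A).
Proof.
apply: measurable_mxP => k j; under eq_fun do rewrite mxE.
exact: measurable_entry.
Qed.

Lemma measurable_coord u k :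
  measurable_fun [set: U] u -> measurable_fun [set: U] (fun x => u x 0 k).
Proof. by move=> mu; exact: measurableT_comp (measurable_entry _ _) mu. Qed.

Lemma measurable_rvB u v : measurable_fun [set: U] u ->
  measurable_fun [set: U] v -> measurable_fun [set: U] (fun x => u x - v x).
Proof.
move=> mu mv; apply: measurable_mxP => i k; rewrite ord1.
under eq_fun do rewrite !mxE.
by apply: measurable_funB; exact: measurable_coord.
Qed.

Lemma dotvE (u v : 'rV[R]_N) : dotv u v = \sum_k u 0 k * v 0 k.
Proof. by rewrite /dotv mxE; apply: eq_bigr => k _; rewrite mxE. Qed.

Lemma measurable_dotv u v : measurable_fun [set: U] u ->
  measurable_fun [set: U] v ->
  measurable_fun [set: U] (fun x => dotv (u x) (v x)).
Proof.
move=> mu mv; under eq_fun do rewrite dotvE.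
by apply: measurable_sum => k; apply: measurable_funM; exact: measurable_coord.
Qed.

End measurable_vectors.

Section dot_product.
Context {R : realType} {N : nat}.
Implicit Types u v w : 'rV[R]_N.

Lemma dotvBr u v w : dotv u (v - w) = dotv u v - dotv u w.
Proof. by rewrite /dotv linearB /= mulmxBr !mxE. Qed.

End dot_product.

(** * Finite means *)

Local Notation mean P X := (fine (expectation P X)).

Section finite_means.
Context {d} {Omega : measurableType d} {R : realType}.
Variable P : probability Omega R.
Implicit Types X Y : Omega -> R.

Let finite_mean_Lfun X : finite_mean P X -> X \in Lfun P 1%E.
Proof. by move=> iX; apply/Lfun1_integrable. Qed.

Lemma finite_meanE X : finite_mean P X -> ('E_P[X] = (mean P X)%:E)%E.
Proof.
by move=> iX; rewrite fineK// expectation_fin_num// finite_mean_Lfun.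
Qed.

Lemma finite_mean_cst (c : R) : finite_mean P (cst c).
Proof. exact: finite_measure_integrable_cst. Qed.

Lemma finite_meanD X Y : finite_mean P X -> finite_mean P Y ->
  finite_mean P (fun x => X x + Y x).
Proof. by move=> iX iY; exact: integrableD iX iY. Qed.

Lemma finite_meanB X Y : finite_mean P X -> finite_mean P Y ->
  finite_mean P (fun x => X x - Y x).
Proof. by move=> iX iY; exact: integrableB iX iY. Qed.

Lemma finite_meanZ (c : R) X : finite_mean P X ->
  finite_mean P (fun x => c * X x).
Proof. by move=> iX; exact: (integrableZl measurableT c iX). Qed.

Lemma finite_mean_sum (I : finType) (X : I -> Omega -> R) :
  (forall i, finite_mean P (X i)) -> finite_mean P (fun x => \sum_i X i x).
Proof.
move=> iX; rewrite /finite_mean (_ : _ \o _ = fun x => (\sum_i (X i x)%:E)%E).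
  by apply: integrable_sum => // i _; exact: iX.
by apply/funext => x /=; rewrite sumEFin.
Qed.

Lemma expectation_fineD X Y : finite_mean P X -> finite_mean P Y ->
  mean P (fun x => X x + Y x) = mean P X + mean P Y.
Proof.
move=> iX iY; rewrite [X in fine X](expectationD (finite_mean_Lfun iX)
  (finite_mean_Lfun iY)).
by rewrite fineD// expectation_fin_num// finite_mean_Lfun.
Qed.

Lemma expectation_fineB X Y : finite_mean P X -> finite_mean P Y ->
  mean P (fun x => X x - Y x) = mean P X - mean P Y.
Proof.
move=> iX iY; rewrite [X in fine X](expectationB (finite_mean_Lfun iX)
  (finite_mean_Lfun iY)).
by rewrite fineB// expectation_fin_num// finite_mean_Lfun.
Qed.

Lemma expectation_fineZ (c : R) X : finite_mean P X ->
  mean P (fun x => c * X x) = c * mean P X.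
Proof.
move=> iX; have := expectationZl c (finite_mean_Lfun iX).
rewrite (finite_meanE iX) -EFinM => E.
rewrite (_ : (fun x => c * X x) = c \o* X)%R ?E//.
by apply/funext => x /=; rewrite mulrC.
Qed.

Lemma expectation_fine_sum (I : finType) (X : I -> Omega -> R) :
  (forall i, finite_mean P (X i)) ->
  mean P (fun x => \sum_i X i x) = \sum_i mean P (X i).
Proof.
move=> iX.
have EX i : (\int[P]_x (X i x)%:E = (mean P (X i))%:E)%E.
  by rewrite -finite_meanE// unlock.
rewrite [in LHS]unlock.
rewrite (_ : (fun x => _) = fun x => (\sum_i (X i x)%:E)%E); last first.
  by apply/funext => x; rewrite sumEFin.
by rewrite integral_sum//= (eq_bigr _ (fun i _ => EX i)) sumEFin.
Qed.

Lemma expectation_fine_cst (c : R) : mean P (cst c) = c.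
Proof. by rewrite expectation_cst. Qed.

Lemma finite_mean_dotv N (p : 'rV[R]_N) (u : Omega -> 'rV[R]_N) :
  finite_meanv P u -> finite_mean P (fun x => dotv p (u x)).
Proof.
move=> iu; under eq_fun do rewrite dotvE.
by apply: finite_mean_sum => k; exact: finite_meanZ.
Qed.

End finite_means.

(** * Averaging out an independent variable *)

Section independence.
Context {d d1 d2 : measure_display} {Omega : measurableType d} {R : realType}.
Context {T1 : measurableType d1} {T2 : measurableType d2}.
Variable P : probability Omega R.
Variables (X : Omega -> T1) (Y : Omega -> T2).
Hypotheses (mX : measurable_fun [set: Omega] X).
Hypotheses (mY : measurable_fun [set: Omega] Y).
Hypothesis XY : independent_RV P X Y.

Let rX : {mfun Omega >-> T1} := mfun_Sub (mem_set mX).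
Let rY : {mfun Omega >-> T2} := mfun_Sub (mem_set mY).
Let rXY : {mfun Omega >-> (T1 * T2)%type} :=
  mfun_Sub (mem_set (measurable_fun_pair mX mY)).

(* Independence says that the joint law and the product law agree on
   rectangles, which generate the product sigma-algebra. *)
Let joint_distribution (C : set (T1 * T2)) : measurable C ->
  (distribution P rX \x distribution P rY)%E C = distribution P rXY C.
Proof.
by move=> mC; apply: product_measure_unique => // A B mA mB; exact: XY.
Qed.

Let integrable_joint (h : T1 * T2 -> R) :
  measurable_fun [set: T1 * T2] h -> finite_mean P (fun x => h (X x, Y x)) ->
  (distribution P rX \x distribution P rY)%E.-integrable [set: T1 * T2]
    (EFin \o h).
Proof.
move=> mh ih; have mEh : measurable_fun [set: T1 * T2] (EFin \o h).
  exact/measurable_EFinP.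
have /integrableP[_ hoo] :
    (distribution P rXY).-integrable [set: T1 * T2] (EFin \o h).
  exact: integrable_pushforward.
apply/integrableP; split => //; apply: le_lt_trans hoo.
rewrite (eq_measure_integral (distribution P rXY))// => C mC _.
exact: joint_distribution.
Qed.

(** Fubini's theorem read on the sample space: for independent X and Y, g is the
    conditional expectation of h(X, Y) given X.  The integrability of g(X) is
    part of the conclusion. *)
Lemma expectation_average (h : T1 * T2 -> R) (g : T1 -> R) :
    measurable_fun [set: T1 * T2] h -> finite_mean P (fun x => h (X x, Y x)) ->
    (forall s, finite_mean P (fun x => h (s, Y x))) ->
    (forall s, mean P (fun x => h (s, Y x)) = g s) ->
  finite_mean P (fun x => g (X x)) /\
  mean P (fun x => g (X x)) = mean P (fun x => h (X x, Y x)).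
Proof.
move=> mh ih ihs hg; have ihXY := integrable_joint mh ih.
have mEh : measurable_fun [set: T1 * T2] (EFin \o h).
  exact/measurable_EFinP.
have gE s : fubini_F (distribution P rY) (EFin \o h) s = (g s)%:E.
  rewrite /fubini_F integral_distribution.
  - by rewrite -hg -finite_meanE// unlock.
  - exact: measurableT_comp mEh (pair1_measurable _).
  - exact: ihs.
have := integrable_fubini_F ihXY; rewrite (funext gE) => ig.
have mg : measurable_fun [set: T1] (EFin \o g) by exact: measurable_int ig.
have igX : finite_mean P (fun x => g (X x)).
  apply/integrableP; split; first exact: measurableT_comp mg mX.
  case/integrableP: ig => _; rewrite ge0_integral_distribution//.
  exact: measurableT_comp mg.
split => //; congr fine; rewrite unlock.
have := integral12_prod_meas1 ihXY; rewrite (funext gE).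
rewrite (integral_distribution mg)// => ->.
rewrite (eq_measure_integral (distribution P rXY))//; last first.
  by move=> C mC _; exact: joint_distribution.
by rewrite integral_distribution.
Qed.

(** Tonelli: under the product law the absolute value of the product has
    integral E|f(X)| E|g(Y)|, so no second moments are required. *)
Lemma finite_meanM (f : T1 -> R) (g : T2 -> R) :
    measurable_fun [set: T1] f -> measurable_fun [set: T2] g ->
    finite_mean P (fun x => f (X x)) -> finite_mean P (fun x => g (Y x)) ->
  finite_mean P (fun x => f (X x) * g (Y x)).
Proof.
move=> mf mg ifX igY; pose h z := f z.1 * g z.2.
have mh : measurable_fun [set: T1 * T2] h.
  by apply: measurable_funM; exact: measurableT_comp.
have mEh : measurable_fun [set: T1 * T2] (EFin \o h) by exact/measurable_EFinP.
have /integrableP[_ hoo] :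
    (distribution P rX \x distribution P rY)%E.-integrable [set: T1 * T2]
      (EFin \o h).
  apply/integrable12ltyP => //.
  under eq_integral => s _.
    under eq_integral => t _ do rewrite /h /= normrM EFinM.
    rewrite ge0_integralZl//; last first.
      exact/measurable_EFinP/measurableT_comp.
    over.
  rewrite ge0_integralZr//; last 2 first.
  - exact/measurable_EFinP/measurableT_comp.
  - exact: integral_ge0.
  have foo : (\int[distribution P rX]_s `|f s|%:E < +oo)%E.
    rewrite ge0_integral_distribution//; first by case/integrableP: ifX.
    exact/measurable_EFinP/measurableT_comp.
  rewrite lte_mul_pinfty//; first exact: integral_ge0.
    by rewrite ge0_fin_numE//; exact: integral_ge0.
  rewrite ge0_integral_distribution//; first by case/integrableP: igY.
  exact/measurable_EFinP/measurableT_comp.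
apply/integrableP; split.
  exact: measurableT_comp mEh (measurable_fun_pair mX mY).
apply: le_lt_trans hoo.
rewrite (eq_measure_integral (distribution P rXY))//; last first.
  by move=> C mC _; exact: joint_distribution.
by rewrite ge0_integral_distribution//; exact: measurableT_comp.
Qed.

(** For each fixed value of X the centered product averages to zero over Y. *)
Lemma covariance_indep0 (f : T1 -> R) (g : T2 -> R) :
    measurable_fun [set: T1] f -> measurable_fun [set: T2] g ->
    finite_mean P (fun x => f (X x)) -> finite_mean P (fun x => g (Y x)) ->
  fine (covariance P (fun x => f (X x)) (fun x => g (Y x))) = 0.
Proof.
move=> mf mg ifX igY.
set a := mean P (fun x => f (X x)); set b := mean P (fun x => g (Y x)).
have iga c : finite_mean P (fun x => (f c - a) * (g (Y x) - b)).
  by apply/finite_meanZ/finite_meanB => //; exact: finite_mean_cst.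
have [] := @expectation_average (fun z => (f z.1 - a) * (g z.2 - b)) (cst 0).
- by apply: measurable_funM; apply: measurable_funB => //;
    exact: measurableT_comp.
- apply: (@finite_meanM (fun s => f s - a) (fun t => g t - b)).
  + exact: measurable_funB.
  + exact: measurable_funB.
  + by apply: finite_meanB => //; exact: finite_mean_cst.
  + by apply: finite_meanB => //; exact: finite_mean_cst.
- exact: iga.
- move=> c /=.
  rewrite expectation_fineZ; last first.
    by apply: finite_meanB => //; exact: finite_mean_cst.
  rewrite expectation_fineB//; last exact: finite_mean_cst.
  by rewrite expectation_fine_cst subrr mulr0.
move=> _; rewrite expectation_fine_cst => e.
by rewrite covariance.unlock [RHS]e.
Qed.

End independence.

Section independence_transfer.
Context {d d1 d2 : measure_display} {Omega : measurableType d} {R : realType}.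
Context {T1 : measurableType d1} {T2 : measurableType d2}.
Variable P : probability Omega R.

Lemma independent_RV_sym (X : Omega -> T1) (Y : Omega -> T2) :
  independent_RV P X Y -> independent_RV P Y X.
Proof. by move=> XY A B mA mB; rewrite setIC XY// muleC. Qed.

Lemma independent_RV_comp d3 (T3 : measurableType d3) (X : Omega -> T1)
    (Y : Omega -> T2) (f : T1 -> T3) :
  measurable_fun [set: T1] f -> independent_RV P X Y ->
  independent_RV P (f \o X) Y.
Proof.
move=> mf XY A B mA mB; rewrite comp_preimage; apply: XY => //.
by rewrite -[X in measurable X]setTI; exact: mf.
Qed.

End independence_transfer.

(** * Prices independent of the customers' states *)

Section random_prices.
Context {d dT : measure_display} {Omega : measurableType d} {R : realType}.
Context {T : measurableType dT} {N : nat}.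
Variables (P : probability Omega R) (W : Omega -> T).
Variable lambda : Omega -> 'rV[R]_N.
Hypothesis mW : measurable_fun [set: Omega] W.
Hypothesis mlambda : measurable_fun [set: Omega] lambda.
Hypothesis lambda_mean : finite_meanv P lambda.
Hypothesis indep : independent_RV P lambda W.

Let finite_mean_lambda v : finite_mean P (fun x => dotv (lambda x) v).
Proof.
rewrite (_ : (fun x => _) = fun x => \sum_k v 0 k * lambda x 0 k).
  by apply: finite_mean_sum => k; exact: finite_meanZ.
by apply/funext => x; rewrite dotvE; apply: eq_bigr => k _; rewrite mulrC.
Qed.

Let mean_lambda v :
  mean P (fun x => dotv (lambda x) v) = dotv (meanv P lambda) v.
Proof.
rewrite (_ : (fun x => _) = fun x => \sum_k v 0 k * lambda x 0 k).
  rewrite expectation_fine_sum; last by move=> k; exact: finite_meanZ.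
  rewrite dotvE; apply: eq_bigr => k _.
  by rewrite expectation_fineZ// mxE mulrC.
by apply/funext => x; rewrite dotvE; apply: eq_bigr => k _; rewrite mulrC.
Qed.

(** The payment at random prices may be replaced by the payment at mean prices
    as soon as the difference a - lambda . b has a mean; a and b themselves
    may fail to have one, as happens for the policies induced by an arbitrary
    tariff. *)
Lemma expectation_price_mean (a : T -> R) (b : T -> 'rV[R]_N) :
    measurable_fun [set: T] a -> measurable_fun [set: T] b ->
    finite_mean P (fun x => a (W x) - dotv (lambda x) (b (W x))) ->
  finite_mean P (fun x => a (W x) - dotv (meanv P lambda) (b (W x))) /\
  mean P (fun x => a (W x) - dotv (meanv P lambda) (b (W x))) =
  mean P (fun x => a (W x) - dotv (lambda x) (b (W x))).
Proof.
move=> ma mb iab.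
pose h (z : T * 'rV[R]_N) := a z.1 - dotv z.2 (b z.1).
pose g w := a w - dotv (meanv P lambda) (b w).
apply: (expectation_average mW mlambda (independent_RV_sym indep)
  (h := h) (g := g)).
- apply: measurable_funB; first exact: measurableT_comp.
  by apply: measurable_dotv => //; exact: measurableT_comp.
- exact: iab.
- move=> w.
  exact: (finite_meanB (finite_mean_cst P (a w)) (finite_mean_lambda (b w))).
- move=> w; have /= -> := expectation_fineB (finite_mean_cst P (a w))
    (finite_mean_lambda (b w)).
  by rewrite expectation_fine_cst mean_lambda.
Qed.

Lemma finite_mean_bill (b : T -> 'rV[R]_N) : measurable_fun [set: T] b ->
    finite_meanv P (fun x => b (W x)) ->
  finite_mean P (fun x => dotv (lambda x) (b (W x))).
Proof.
move=> mb ib; under eq_fun do rewrite dotvE.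
apply: finite_mean_sum => k.
apply: (finite_meanM mlambda mW indep
  (f := fun l => l 0 k) (g := fun w => b w 0 k)) => //.
- exact: measurable_entry.
- exact: measurable_coord.
Qed.

Lemma mean_bill (b : T -> 'rV[R]_N) : measurable_fun [set: T] b ->
    finite_meanv P (fun x => b (W x)) ->
  mean P (fun x => dotv (lambda x) (b (W x))) =
  mean P (fun x => dotv (meanv P lambda) (b (W x))).
Proof.
move=> mb ib; have il := finite_mean_bill mb ib.
have ip := finite_mean_dotv (meanv P lambda) ib.
have i0 : finite_mean P (cst 0) := finite_mean_cst P 0.
have m0 : measurable_fun [set: T] (cst 0 : T -> R) by exact: measurable_cst.
have [_] := expectation_price_mean m0 mb (finite_meanB i0 il).
by rewrite !expectation_fineB// expectation_fine_cst !sub0r => /oppr_inj.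
Qed.

Lemma trace_cov0 (b : T -> 'rV[R]_N) : measurable_fun [set: T] b ->
    finite_meanv P (fun x => b (W x)) ->
  \tr (covmx P lambda (fun x => b (W x))) = 0.
Proof.
move=> mb ib; apply: big1 => k _; rewrite mxE.
apply: (covariance_indep0 mlambda mW indep
  (f := fun l => l 0 k) (g := fun w => b w 0 k)) => //.
- exact: measurable_entry.
- exact: measurable_coord.
Qed.

End random_prices.

(** * Customers facing a two-part tariff *)

Section storage.
Context {R : realType} {N : nat}.

(** A discharge is the difference of two successive levels of stored energy,
    and both levels lie in [0, theta]. *)
Lemma storage_feasible_bounded (theta : R) (s : 'rV[R]_N) k :
  storage_feasible theta s -> `|s 0 k| <= theta.
Proof.
move=> fs.
have sk : \sum_(t < N | (t <= k)%N) s 0 t =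
    s 0 k + \sum_(t < N | (t < k)%N) s 0 t.
  rewrite (bigD1 k)//=; congr (_ + _); apply: eq_bigl => t.
  by rewrite ltn_neqAle andbC.
have /andP[lo hi] := fs k; rewrite sk in lo hi.
(* The level before period 0 is zero; later ones are constrained through
   the preceding period. *)
have /andP[lo' hi'] : 0 <= - \sum_(t < N | (t < k)%N) s 0 t <= theta.
  case: k {sk lo hi} (fs k) => -[|k] kN /=.
    by move=> /andP[l h]; rewrite big_pred0// oppr0 lexx (le_trans l h).
  by move=> _; exact: (fs (Ordinal (ltnW kN))).
by rewrite ler_norml; apply/andP; split; lra.
Qed.

End storage.

Section customer.
Context {d : measure_display} {Omega : measurableType d}.
Context {R : realType} {N : nat}.
Variables (P : probability Omega R) (W : Omega -> 'rV[R]_N).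
Variables (S : 'rV[R]_N -> 'rV[R]_N -> R) (r : 'rV[R]_N -> 'rV[R]_N).
Variable theta : R.
Hypothesis mW : measurable_fun [set: Omega] W.
Hypothesis r_mean : finite_meanv P (fun x => r (W x)).

Lemma finite_mean_storage (s : 'rV[R]_N -> 'rV[R]_N) :
    measurable_fun [set: 'rV[R]_N] s ->
    (forall x, storage_feasible theta (s (W x))) ->
  finite_meanv P (fun x => s (W x)).
Proof.
move=> ms fs k; apply: (le_integrable _ _ _ (finite_mean_cst P theta)) => //.
  by apply/measurable_EFinP/measurable_coord; exact: measurableT_comp.
move=> x _ /=; rewrite lee_fin (le_trans (storage_feasible_bounded k (fs x)))//.
exact: ler_norm.
Qed.

Lemma net_surplus_two_part A p qs :
  net_surplus W S r (two_part_tariff A p) qs =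
  fun x => linear_surplus W S p qs.1 x +
    (dotv p (r (W x)) + dotv p (qs.2 (W x)) - A).
Proof.
apply/funext => x; rewrite /net_surplus /two_part_tariff /net_demand !dotvBr.
by rewrite /linear_surplus; ring.
Qed.

(** A linear tariff decouples consumption from storage, and renewables enter
    the objective through an additive term.  To compare with a rival pair
    (q', s'), the consumption part of its objective must first be shown to have
    a mean, which holds because the renewables do and storage policies are
    bounded. *)
Lemma two_part_optimal_choice A p q s :
    is_demand P W S p q -> optimal_discharge p theta s ->
  optimal_choice P W S r theta (two_part_tariff A p) (q, fun=> s).
Proof.
move=> [cq iq q_max] [fs s_max].
pose rest (s' : 'rV[R]_N -> 'rV[R]_N) x :=
  dotv p (r (W x)) + dotv p (s' (W x)) - A.
have irest s' : causal_policy s' ->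
    (forall x, storage_feasible theta (s' (W x))) ->
    finite_mean P (rest s').
  move=> [ms' _] fs'; apply: finite_meanB; last exact: finite_mean_cst.
  apply: finite_meanD; apply: finite_mean_dotv => //.
  exact: finite_mean_storage.
have cs : causal_policy (fun=> s) by split; [exact: measurable_cst|].
have adm : admissible P W S r theta (two_part_tariff A p) (q, fun=> s).
  split => //; rewrite net_surplus_two_part.
  by apply: finite_meanD => //; exact: irest.
split => //; apply/eqP; rewrite eq_le; apply/andP; split.
  by apply: ereal_sup_ubound; exists (q, fun=> s).
apply: ge_ereal_sup => _ [[q' s'] [/= cq' cs' fs' iq's'] <-].
have is' := irest _ cs' fs'.
have is0 := irest _ cs (fun=> fs).
have iq' : finite_mean P (linear_surplus W S p q').
  have := finite_meanB iq's' is'; rewrite net_surplus_two_part /=.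
  by under eq_fun do rewrite addrK.
have [_ _ _ i0] := adm.
rewrite (finite_meanE iq's') (finite_meanE i0) lee_fin.
rewrite !net_surplus_two_part /= (expectation_fineD iq' is').
rewrite (expectation_fineD iq is0).
apply: lerD.
  by rewrite -lee_fin -(finite_meanE iq') -(finite_meanE iq); exact: q_max.
rewrite -lee_fin -(finite_meanE is') -(finite_meanE is0) unlock.
apply: le_integral => // x _.
by rewrite lee_fin lerB// lerD2l; exact: s_max.
Qed.

End customer.

(** * Retail margins *)

Section retail_margin.
Context {d : measure_display} {Omega : measurableType d}.
Context {R : realType} {N : nat}.
Variables (P : probability Omega R) (W lambda : Omega -> 'rV[R]_N).
Hypothesis mW : measurable_fun [set: Omega] W.
Hypothesis mlambda : measurable_fun [set: Omega] lambda.
Hypothesis lambda_mean : finite_meanv P lambda.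
Hypothesis indep : independent_RV P lambda W.

Let pbar := meanv P lambda.

(** The margin for a prescribed net demand: unlike [retailer_margin], it does not
    presuppose a rule selecting one policy for every tariff. *)
Definition net_margin (T : 'rV[R]_N -> R) (net : Omega -> 'rV[R]_N) :
    Omega -> R :=
  fun x => T (net x) - dotv (lambda x) (net x).

(** A tariff priced at the mean of lambda resells energy at its expected cost,
    so the fixed charge is the whole expected margin. *)
Lemma net_margin_two_part A (b : 'rV[R]_N -> 'rV[R]_N) :
    measurable_fun [set: 'rV[R]_N] b -> finite_meanv P (fun x => b (W x)) ->
  let margin := net_margin (two_part_tariff A pbar) (fun x => b (W x)) in
  finite_mean P margin /\ mean P margin = A.
Proof.
move=> mb ib margin.
have il := finite_mean_bill mW mlambda lambda_mean indep mb ib.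
have ip := finite_mean_dotv pbar ib.
have iA := finite_mean_cst P A.
have iAp := finite_meanD iA ip.
split; first exact: finite_meanB.
rewrite (expectation_fineB iAp il) (expectation_fineD iA ip).
rewrite expectation_fine_cst (mean_bill mW mlambda lambda_mean indep mb ib).
by rewrite addrK.
Qed.

Variables (S : 'rV[R]_N -> 'rV[R]_N -> R) (r : 'rV[R]_N -> 'rV[R]_N).
Variable theta : R.
Hypothesis mS : measurable_fun [set: 'rV[R]_N * 'rV[R]_N]
  (fun qw : 'rV[R]_N * 'rV[R]_N => S qw.1 qw.2).
Hypothesis mr : measurable_fun [set: 'rV[R]_N] r.

(** The accounting inequality behind the theorem: surplus and margin under T
    share a total that depends only on the policy qs, and at mean prices this
    total is the objective of the two-part tariff plus its fixed charge A; qs is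
    one of the policies over which the two-part surplus is a supremum. *)
Lemma customer_surplus_bound A T qs :
    let margin := net_margin T (net_demand W r qs) in
    admissible P W S r theta T qs -> finite_mean P margin ->
  ((mean P (net_surplus W S r T qs))%:E <=
   customer_surplus P W S r theta (two_part_tariff A pbar) +
   (A - mean P margin)%:E)%E.
Proof.
move=> margin [cq cs fs insT] im.
have [[mq _] [ms _]] := (cq, cs).
pose a w := S (qs.1 w) w.
pose b w := qs.1 w - r w - qs.2 w.
have ma : measurable_fun [set: 'rV[R]_N] a.
  exact: measurableT_comp mS (measurable_fun_pair mq (@measurable_id _ _ _)).
have mb : measurable_fun [set: 'rV[R]_N] b.
  by apply: measurable_rvB => //; exact: measurable_rvB.
(* The payment cancels in the total of surplus and margin. *)
have sumE : (fun x => net_surplus W S r T qs x + margin x) =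
    (fun x => a (W x) - dotv (lambda x) (b (W x))).
  by apply/funext => x; rewrite /net_surplus /margin /net_margin addrA subrK.
have iab := finite_meanD insT im; rewrite sumE in iab.
have [iabp Eab] :=
  expectation_price_mean mW mlambda lambda_mean indep ma mb iab.
have nsE : net_surplus W S r (two_part_tariff A pbar) qs =
    (fun x => (a (W x) - dotv pbar (b (W x))) - cst A x).
  apply/funext => x; rewrite /net_surplus /two_part_tariff /=.
  by rewrite opprD addrCA addrC.
have iA := finite_mean_cst P A.
have ins : finite_mean P (net_surplus W S r (two_part_tariff A pbar) qs).
  by rewrite nsE; exact: finite_meanB.
have Ens : mean P (net_surplus W S r T qs) =
    mean P (net_surplus W S r (two_part_tariff A pbar) qs) +
    (A - mean P margin).
  rewrite nsE (expectation_fineB iabp iA) expectation_fine_cst Eab -sumE.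
  by rewrite (expectation_fineD insT im); lra.
rewrite Ens EFinD leeD2r// -(finite_meanE ins).
by apply: ereal_sup_ubound; exists qs.
Qed.

End retail_margin.

(** * Optimality of the mean-price tariff *)

Theorem theorem2 (d : measure_display) (Omega : measurableType d)
    (R : realType) (P : probability Omega R) (M N : nat) (M_gt0 : (0 < M)%N)
    (lambda : {RV P >-> 'rV[R]_N}) (omega : {RV P >-> 'M[R]_(M, N)})
    (F : R)
    (S : 'I_M -> 'rV[R]_N -> 'rV[R]_N -> R)
    (D : 'I_M -> 'rV[R]_N -> 'rV[R]_N -> 'rV[R]_N)
    (prices : set 'rV[R]_N)
    (sstar : 'rV[R]_N -> R -> 'rV[R]_N)
    (r : 'I_M -> 'rV[R]_N -> 'rV[R]_N) (theta : 'I_M -> R)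
    (choice : ('rV[R]_N -> R) -> 'I_M ->
      ('rV[R]_N -> 'rV[R]_N) * ('rV[R]_N -> 'rV[R]_N))
    (lambda_mean : finite_meanv P lambda)
    (S_meas : forall i, measurable_fun [set: 'rV[R]_N * 'rV[R]_N]
      (fun qw : 'rV[R]_N * 'rV[R]_N => S i qw.1 qw.2))
    (prices_open : open prices) (prices_mean : prices (meanv P lambda))
    (D_opt : forall i pi, prices pi ->
      is_demand P (local_state omega i) (S i) pi (D i pi))
    (D_reg : regular_demand omega D prices)
    (D_mean : forall i,
      finite_meanv P (fun x => D i (meanv P lambda) (local_state omega i x)))
    (g_reg : regular_g P lambda omega D prices)
    (sstar_opt : forall pi th, 0 <= th -> optimal_discharge pi th (sstar pi th))
    (r_meas : forall i, measurable_fun [set: 'rV[R]_N] (r i))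
    (r_ge0 : forall i x k, 0 <= r i (local_state omega i x) 0 k)
    (r_mean : forall i, finite_meanv P (fun x => r i (local_state omega i x)))
    (theta_ge0 : forall i, 0 <= theta i)
    (choice_opt : rational_choice P omega S r theta choice)
    (choice_two_part : forall A pi i, prices pi ->
      choice (two_part_tariff A pi) i = (D i pi, fun=> sstar pi (theta i)))
    (indep : independent_RV P lambda omega) :
  regulator_optimal P lambda omega S r theta choice F
    (T_dec P lambda omega D r F).
Proof.
set p := meanv P lambda.
set A := A_dec P lambda omega D r F.
have mlambda : measurable_fun [set: Omega] lambda by exact: measurable_funP.
have momega : measurable_fun [set: Omega] omega by exact: measurable_funP.
have mrow (i : 'I_M) : measurable_fun [set: 'M[R]_(M, N)] (fun w => row i w).
  exact: measurable_row.
have mW i : measurable_fun [set: Omega] (local_state omega i).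
  exact: measurableT_comp.
have indepW i : independent_RV P lambda (local_state omega i).
  by apply/independent_RV_sym/(independent_RV_comp (mrow i))/independent_RV_sym.
have mD i : measurable_fun [set: 'rV[R]_N] (D i p).
  by have [[]] := D_opt i p prices_mean.
have cov_sum (b : 'I_M -> 'rV[R]_N -> 'rV[R]_N) :
    (forall i, measurable_fun [set: 'rV[R]_N] (b i)) ->
    (forall i, finite_meanv P (fun x => b i (local_state omega i x))) ->
  \tr (covmx P lambda (fun x => \sum_i b i (local_state omega i x))) = 0.
  move=> mb ib.
  apply: (trace_cov0 momega mlambda lambda_mean indep
    (b := fun w : 'M[R]_(M, N) => \sum_i b i (row i w))).
    apply: measurable_mxP => j k; rewrite ord1.
    under eq_fun do rewrite summxE.
    apply: measurable_sum => i; apply: measurable_coord.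
    exact: measurableT_comp.
  move=> k; under eq_fun do rewrite summxE.
  by apply: finite_mean_sum => i; exact: ib.
have covD : \tr (covmx P lambda (total_demand omega D p)) = 0.
  by apply: (cov_sum (fun i => D i p)) => // i; exact: D_mean.
have covr : \tr (covmx P lambda (total_renewables omega r)) = 0.
  exact: cov_sum.
(* Independence kills both covariance corrections, so the fixed charges alone
   finance F. *)
have MA : \sum_(i < M) A = F.
  rewrite sumr_const card_ord -mulr_natl /A /A_dec /A_star.
  rewrite covD covr mulr0 subr0 addr0 mulVKf//.
  by rewrite pnatr_eq0 -lt0n.
set Tdec := T_dec P lambda omega D r F.
have choiceE i : choice Tdec i =
    (D i p, fun=> sstar p (theta i)) by exact: choice_two_part.
have opt i : optimal_choice P (local_state omega i) (S i) (r i) (theta i)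
    Tdec (choice Tdec i).
  rewrite choiceE; apply: two_part_optimal_choice => //.
  - exact: D_opt.
  - exact: sstar_opt.
have margin_dec i : finite_mean P
      (retailer_margin lambda omega r choice Tdec i) /\
    mean P (retailer_margin lambda omega r choice Tdec i) = A.
  rewrite /retailer_margin choiceE.
  apply: (net_margin_two_part (mW i) mlambda lambda_mean (indepW i) A
    (b := fun w => D i p w - r i w - sstar p (theta i))).
    apply: measurable_rvB; last exact: measurable_cst.
    exact: measurable_rvB.
  move=> k; under eq_fun do rewrite !mxE.
  apply: finite_meanB; last exact: finite_mean_cst.
  by apply: finite_meanB; [exact: D_mean|exact: r_mean].
have rsE T' :
    (forall i, finite_mean P (retailer_margin lambda omega r choice T' i)) ->
    rs_bar P lambda omega r choice T' =
    (\sum_i mean P (retailer_margin lambda omega r choice T' i))%:E.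
  move=> im; rewrite /rs_bar finite_meanE ?expectation_fine_sum//.
  exact: finite_mean_sum.
split.
  split => //; first by move=> i; have [] := margin_dec i.
  rewrite rsE; last by move=> i; have [] := margin_dec i.
  rewrite -[in RHS]MA; congr (_%:E).
  by apply: eq_bigr => i _; have [] := margin_dec i.
move=> T' [optT' imT' rsT'].
move: rsT'; rewrite rsE// => -[rsT'].
set c := fun T i =>
  customer_surplus P (local_state omega i) (S i) (r i) (theta i) T.
have cfin T i : optimal_choice P (local_state omega i) (S i) (r i) (theta i) T
    (choice T i) ->
    c T i = (mean P
      (net_surplus (local_state omega i) (S i) (r i) T (choice T i)))%:E.
  by case=> -[_ _ _ ins] e; rewrite /c -e (finite_meanE ins).
rewrite /cs_bar.
have bound i : (c T' i <= c Tdec i +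
    (A - mean P (retailer_margin lambda omega r choice T' i))%:E)%E.
  rewrite cfin//; have [adm _] := optT' i.
  apply: (customer_surplus_bound (mW i) mlambda lambda_mean (indepW i)) => //.
  exact: imT'.
apply: (le_trans (lee_sum _ (fun i _ => bound i))).
rewrite big_split /= sumEFin sumrB MA rsT' subrr adde0.
exact: lexx.
Qed.
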